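(* Let $n\ge 2$ and $N_1,N_2\ge 0$ be integers. The image of the set of $\hat{\mathcal{G}}_{-N_1}^{N_2}(2n+1)$-monomials in $AQ_{-N_1}^{N_2}(2n+1)$ is a basis of $AQ_{-N_1}^{N_2}(2n+1)$ over $\mathbb{C}$.
   Context: The algebra: consider the polynomial ring over $\mathbb{C}$ in variables $f^i[s],g_j[t],h[k]$, $1\le i,j\le n$, $-N_1\le s,t,k\le N_2$. Then $$AQ_{-N_1}^{N_2}(2n+1)=\mathbb{C}[f^i[s],g_j[t],h[k]]/(r[-2N_1],\dots,r[2N_2]),\qquad r[l]=\sum_{s+t=l}\Big(\sum_{i=1}^n f^i[s]g_i[t]+h[s]h[t]\Big).$$ The weakly partially ordered set: a weakly partially ordered set is a set with an antisymmetric and transitive relation $\le$ for which reflexivity $a\le a$ may fail for some exceptional elements $a$. For $n\ge 2$ let $\hat{\mathcal G}(2n+1)$ be the set of symbols $f^i[t],g_i[t],h[t]$ ($1\le i\le n$, $t\in\mathbb{Z}$) with the order generated by transitivity from the following relations, for all $t\in\mathbb{Z}$: $f^{i+1}[t]<f^i[t]$ for $1\le i\le n-1$; $f^1[t]<h[t]<g_1[t]$; $g_i[t]<g_{i+1}[t]$ for $1\le i\le n-1$; $g_{n-1}[t]<f^n[t+1]$; $g_n[t]<f^{n-1}[t+1]$; and with $a\le a$ for every $a=f^i[t]$ or $g_i[t]$, while the elements $h[t]$ are exceptional: $h[t]\le h[t]$ does not hold. (The only incomparable pairs of distinct elements are $\{g_n[t],f^n[t+1]\}$.) The set $\hat{\mathcal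 G}_{-N_1}^{N_2}(2n+1)$ is the interval from $f^n[-N_1]$ to $g_n[N_2]$; it consists exactly of the $f^i[t],g_i[t],h[t]$ with $-N_1\le t\le N_2$, i.e. of the generators of the algebra. Monomials: a monomial $e_{\alpha_1}\cdots e_{\alpha_k}$ in the generators is a $\hat{\mathcal G}_{-N_1}^{N_2}(2n+1)$-monomial if for all $i\ne j$ the elements $\alpha_i,\alpha_j$ are comparable ($\alpha_i\le\alpha_j$ or $\alpha_j\le\alpha_i$); in particular, each $h[t]$ occurs with exponent at most $1$. *)

(* Defs.v *)
From HB Require Import structures.
From mathcomp Require Import all_boot all_order all_algebra.
From mathcomp Require Import generic_quotient ring_quotient.
From mathcomp Require Import boolp classical_sets reals.
From mathcomp Require Import complex mpoly.

Set Implicit Arguments.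
Unset Strict Implicit.
Unset Printing Implicit Defensive.

Import Order.TTheory GRing.Theory Num.Theory.
Local Open Scope ring_scope.
Local Open Scope quotient_scope.
Local Open Scope classical_set_scope.

(* Symbols f^i[t], g_i[t], h[t] with labels t in an arbitrary type T: T = int
   gives \hat G(2n+1), T = 'I_(N1 + N2).+1 gives the generators of the algebra.
   Upper and lower indices 1 <= i <= n are shifted to 0 <= i < n. *)
Inductive sym (n : nat) (T : Type) : Type :=
| symf of 'I_n & T
| symg of 'I_n & T
| symh of T.
Arguments symf {n T}.
Arguments symg {n T}.
Arguments symh {n T}.

Section SymFinite.
Variables (n : nat) (T : Type).

Definition sym_code (a : sym n T) : ('I_n * T + 'I_n * T) + T :=
  match a with
  | symf i t => inl (inl (i, t))
  | symg i t => inl (inr (i, t))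
  | symh t => inr t
  end.

Definition sym_decode (c : ('I_n * T + 'I_n * T) + T) : sym n T :=
  match c with
  | inl (inl (i, t)) => symf i t
  | inl (inr (i, t)) => symg i t
  | inr t => symh t
  end.

Lemma sym_codeK : cancel sym_code sym_decode.
Proof. by case. Qed.
End SymFinite.

HB.instance Definition _ (n : nat) (T : eqType) :=
  Equality.copy (sym n T) (can_type (@sym_codeK n T)).
HB.instance Definition _ (n : nat) (T : choiceType) :=
  Choice.copy (sym n T) (can_type (@sym_codeK n T)).
HB.instance Definition _ (n : nat) (T : countType) :=
  Countable.copy (sym n T) (can_type (@sym_codeK n T)).
HB.instance Definition _ (n : nat) (T : finType) :=
  Finite.copy (sym n T) (can_type (@sym_codeK n T)).

(* The weak partial order of \hat G(2n+1): reflexive at the f's and g's only. *)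
Inductive wle (n : nat) : sym n int -> sym n int -> Prop :=
| wle_ff (i j : 'I_n) t : j = i.+1 :> nat -> wle (symf j t) (symf i t)
| wle_fh (i : 'I_n) t : i = 0%N :> nat -> wle (symf i t) (symh t)
| wle_hg (i : 'I_n) t : i = 0%N :> nat -> wle (symh t) (symg i t)
| wle_gg (i j : 'I_n) t : j = i.+1 :> nat -> wle (symg i t) (symg j t)
| wle_gf (i j : 'I_n) t : i.+2 = n -> j.+1 = n ->
    wle (symg i t) (symf j (t + 1))
| wle_gf' (i j : 'I_n) t : i.+1 = n -> j.+2 = n ->
    wle (symg i t) (symf j (t + 1))
| wle_refl_f (i : 'I_n) t : wle (symf i t) (symf i t)
| wle_refl_g (i : 'I_n) t : wle (symg i t) (symg i t)
| wle_trans a b c : wle a b -> wle b c -> wle a c.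

Definition wcomparable (n : nat) (a b : sym n int) : Prop := wle a b \/ wle b a.

Section Algebra.
Variables (K : fieldType) (n N1 N2 : nat).

Local Notation label := 'I_(N1 + N2)%N.+1.

(* The label s stands for the integer s - N1, which ranges over [-N1, N2]. *)
Definition lab (s : label) : int := s%:Z - N1%:Z.

Definition gen := sym n label.

Definition gen_sym (a : gen) : sym n int :=
  match a with
  | symf i s => symf i (lab s)
  | symg i s => symg i (lab s)
  | symh s => symh (lab s)
  end.

Definition genpoly := {mpoly K[#|{: gen}|]}.

Definition var (a : gen) : genpoly := 'X_(enum_rank a).

Definition AQ_rel (l : int) : genpoly :=
  \sum_(s : label) \sum_(t : label | lab s + lab t == l)
    (\sum_(i < n) var (symf i s) * var (symg i t) + var (symh s) * var (symh t)).

(* The ideal (r[-2N_1], ..., r[2N_2]); the index k stands for l = k - 2N_1. *)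
Definition AQ_ideal : {pred genpoly} := fun p =>
  `[< exists c : 'I_(2 * (N1 + N2))%N.+1 -> genpoly,
        p = \sum_k c k * AQ_rel (k%:Z - (2 * N1)%N%:Z) >].

Lemma AQ_rel_coef0 l : (AQ_rel l)@_0%MM = 0.
Proof.
have X0 (a b : gen) : (var a * var b)@_0%MM = 0.
  by rewrite /var -mpolyXD mcoeffX mnmD_eq0 mnm1_eq0.
rewrite /AQ_rel raddf_sum big1 // => s _; rewrite raddf_sum big1 // => t _.
rewrite raddfD /= X0 addr0 raddf_sum big1 // => i _; exact: X0.
Qed.

Lemma AQ_idealr_closed : idealr_closed AQ_ideal.
Proof.
split.
- by apply/asboolP; exists (fun=> 0); rewrite big1 // => k _; rewrite mul0r.
- apply/negP => /asboolP[c /(congr1 (mcoeff 0%MM))]; rewrite mcoeff1 eqxx.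
  rewrite raddf_sum big1 => [/eqP|k _]; first by rewrite oner_eq0.
  by rewrite /= rmorphM /= AQ_rel_coef0 mulr0.
- move=> a p q /asboolP[c ->] /asboolP[d ->]; apply/asboolP.
  exists (fun k => a * c k + d k); rewrite mulr_sumr -big_split /=.
  by apply: eq_bigr => k _; rewrite mulrDl mulrA.
Qed.

HB.instance Definition _ := isIdealr.Build genpoly AQ_ideal AQ_idealr_closed.

Definition AQ := {ideal_quot AQ_ideal}.
HB.instance Definition _ := GRing.ComNzRing.on AQ.

Definition AQ_pi (p : genpoly) : AQ := \pi_{ideal_quot AQ_ideal} p.

Lemma AQ_piP p q : AQ_pi p = AQ_pi q <-> p - q \in AQ_ideal.
Proof.
have E : (AQ_pi p == AQ_pi q) = (p - q \in AQ_ideal).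
  exact: (@eqquotE _ _ {ideal_quot AQ_ideal} p q).
by rewrite -E; split=> [/eqP|/eqP].
Qed.

Lemma AQ_pi_surj (x : AQ) : exists p, AQ_pi p = x.
Proof. by exists (repr x); rewrite /AQ_pi reprK. Qed.

Lemma AQ_piB : {morph AQ_pi : p q / p - q}.
Proof. exact: rmorphB. Qed.

Lemma AQ_pi_monoid_morphism : monoid_morphism AQ_pi.
Proof. by split; [exact: rmorph1 | exact: rmorphM]. Qed.

HB.instance Definition _ :=
  GRing.isZmodMorphism.Build genpoly AQ AQ_pi AQ_piB.
HB.instance Definition _ :=
  GRing.isMonoidMorphism.Build genpoly AQ AQ_pi AQ_pi_monoid_morphism.

Definition AQ_scale (c : K) (x : AQ) : AQ := AQ_pi c%:MP * x.

Lemma AQ_scaleA a b x : AQ_scale a (AQ_scale b x) = AQ_scale (a * b) x.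
Proof. by rewrite /AQ_scale mulrA -rmorphM /= -mpolyCM. Qed.

Lemma AQ_scale1 : left_id 1 AQ_scale.
Proof. by move=> x; rewrite /AQ_scale mpolyC1 rmorph1 mul1r. Qed.

Lemma AQ_scaleDr : right_distributive AQ_scale +%R.
Proof. by move=> a x y; rewrite /AQ_scale mulrDr. Qed.

Lemma AQ_scaleDl x : {morph AQ_scale^~ x : a b / a + b}.
Proof. by move=> a b; rewrite /AQ_scale mpolyCD rmorphD mulrDl. Qed.

HB.instance Definition _ := GRing.Zmodule_isLmodule.Build K AQ
  AQ_scaleA AQ_scale1 AQ_scaleDr AQ_scaleDl.

Lemma AQ_scaleAl (c : K) (x y : AQ) : c *: (x * y) = c *: x * y.
Proof. exact: mulrA. Qed.

HB.instance Definition _ := GRing.Lmodule_isLalgebra.Build K AQ AQ_scaleAl.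
HB.instance Definition _ := GRing.Lalgebra_isComAlgebra.Build K AQ.

Lemma AQ_pi_scalable : scalable AQ_pi.
Proof. by move=> c p; rewrite -mul_mpolyC rmorphM. Qed.

HB.instance Definition _ := GRing.isScalable.Build K genpoly AQ *:%R AQ_pi
  AQ_pi_scalable.

(* e_{a_1} ... e_{a_k} with a_i, a_j comparable for all positions i <> j, so
   that a repeated factor must be comparable to itself. *)
Definition Gmonomials : set genpoly :=
  [set p | exists k (a : 'I_k -> gen),
     p = \prod_(i < k) var (a i) /\
     forall i j, i != j -> wcomparable (gen_sym (a i)) (gen_sym (a j))].

End Algebra.

Arguments AQ_pi : clear implicits.
Arguments Gmonomials : clear implicits.

Definition lin_independent (K : fieldType) (V : lmodType K) (B : set V) : Prop :=
  forall (s : seq V) (c : V -> K), uniq s -> (forall x, x \in s -> B x) ->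
    \sum_(x <- s) c x *: x = 0 -> forall x, x \in s -> c x = 0.

Definition spanning (K : fieldType) (V : lmodType K) (B : set V) : Prop :=
  forall v : V, exists (s : seq V) (c : V -> K),
    (forall x, x \in s -> B x) /\ v = \sum_(x <- s) c x *: x.

Definition is_basis (K : fieldType) (V : lmodType K) (B : set V) : Prop :=
  lin_independent B /\ spanning B.

(* Main.v *)
(* The two incomparable kinds of pairs, h[t], h[t] and g_n[t], f^n[t+1], lie at
   equal heights for the position f^i[t] = 2nt - i, h[t] = 2nt, g_i[t] = 2nt + i,
   and every product occurring in r[l] has the same sum of positions. Hence, for
   the weight (constant) - (position)^2, the unique heaviest term of r[2t] is
   h[t]^2 and that of r[2t+1] is f^n[t+1] g_n[t]. These leading monomials are
   pairwise coprime, so each monomial is uniquely s * \prod_k lead_k^(a_k) with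
   s divisible by no lead_k, and substituting r_k for lead_k gives a linear
   endomorphism T of the polynomial ring that is the identity up to lower
   weight, hence bijective. As T (p lead_k) = T p * r_k, it maps the monomial
   ideal of the lead_k onto the ideal of the r_k and fixes the monomials divisible
   by no lead_k, which are the monomials of the theorem. *)
Require Import Defs.
From HB Require Import structures.
From mathcomp Require Import all_boot all_order all_algebra.
From mathcomp Require Import zify.
From mathcomp Require Import boolp classical_sets reals.
From mathcomp Require Import complex mpoly.
Local Open Scope ring_scope.
Local Open Scope complex_scope.
Local Open Scope classical_set_scope.

Import Order.TTheory GRing.Theory Num.Theory.

(** * Ideals generated by deformations of pairwise coprime monomials *)

Section CoprimeLeadMonomials.
Set Implicit Arguments.
Unset Strict Implicit.
Unset Printing Implicit Defensive.

Variables (K : fieldType) (n : nat) (I : finType).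
Variables (W : 'X_{1..n} -> nat) (lead : I -> 'X_{1..n}) (r : I -> {mpoly K[n]}).

Hypothesis weightD : forall m1 m2, W (m1 + m2)%MM = (W m1 + W m2)%N.
Hypothesis lead_neq0 : forall k, lead k != 0%MM.
Hypothesis lead_coprime :
  forall j k i, j != k -> (lead j i == 0)%N || (lead k i == 0)%N.

(** The bound is strict, so that [lower 0 p] forces [p = 0]; the induction in [basis_map_surj]
    starts there. *)
Definition lower d (p : {mpoly K[n]}) := forall m, m \in msupp p -> (W m < d)%N.

Hypothesis r_lead : forall k, lower (W (lead k)) (r k - 'X_[lead k]).

Lemma lowerD d p q : lower d p -> lower d q -> lower d (p + q).
Proof.
by move=> hp hq m /msuppD_le; rewrite mem_cat => /orP[/hp|/hq].
Qed.

Lemma lowerN d p : lower d p -> lower d (- p).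
Proof. by move=> hp m; rewrite (perm_mem (msuppN p)) => /hp. Qed.

Lemma lowerZ d c p : lower d p -> lower d (c *: p).
Proof. by move=> hp m /msuppZ_le/hp. Qed.

Lemma lower_sum d (J : eqType) (s : seq J) (P : pred J) (F : J -> {mpoly K[n]}) :
  (forall j, j \in s -> P j -> lower d (F j)) -> lower d (\sum_(j <- s | P j) F j).
Proof.
move=> hF; rewrite big_seq_cond; elim/big_ind: _.
- by move=> m; rewrite msupp0.
- exact: lowerD.
- by move=> j /andP[js Pj]; apply: hF.
Qed.

Lemma lowerX d m : (W m < d)%N -> lower d 'X_[m].
Proof. by move=> hm m' /mem_msuppXP <-. Qed.

(** Strictness of one factor is enough: [lower d2.+1 q] only says that [q] has weight at most
    [d2]. *)
Lemma lowerM d1 d2 p q : lower d1 p -> lower d2.+1 q -> lower (d1 + d2) (p * q).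
Proof.
move=> hp hq m /msuppM_le/allpairsP[[m1 m2] /= [/hp h1 /hq h2 ->]].
by rewrite weightD -addSn leq_add.
Qed.

Lemma lower_coef d p m : lower d p -> (d <= W m)%N -> p@_m = 0.
Proof.
move=> hp hd; apply/memN_msupp_eq0/negP => /hp.
by rewrite ltnNge hd.
Qed.

Definition standard m := [forall k, ~~ (lead k <= m)%MM].

(* The fuel d never runs out when mdeg m <= d, as the lead k are not 0. *)
Fixpoint replace_lead d m : {mpoly K[n]} :=
  if d isn't d'.+1 then 'X_[m] else
  if [pick k | (lead k <= m)%MM] is Some k
  then replace_lead d' (m - lead k)%MM * r k else 'X_[m].

Lemma mdeg_subl k m : (lead k <= m)%MM -> (mdeg (m - lead k)%MM < mdeg m)%N.
Proof.
move=> km; rewrite -{2}(submK km) mdegD -[X in (X < _)%N]addn0 ltn_add2l.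
by rewrite lt0n mdeg_eq0.
Qed.

Lemma replace_lead_fuel d e m : (mdeg m <= d)%N -> (mdeg m <= e)%N ->
  replace_lead d m = replace_lead e m.
Proof.
have fuelE f x : (mdeg x <= f)%N -> replace_lead f x = replace_lead (mdeg x) x.
  elim/ltn_ind: f x => f IH x hx; case xE: (mdeg x) => [|e'].
    case: f {IH hx} => //= f; case: pickP => // k kx.
    by have := mdeg_subl kx; rewrite xE.
  case: f IH hx => [|f] IH hx; first by rewrite xE in hx.
  rewrite /=; case: pickP => // k kx.
  have lt := mdeg_subl kx; rewrite xE ltnS in lt; rewrite xE ltnS in hx.
  rewrite IH //; last exact: leq_trans hx.
  by rewrite [in RHS]IH.
by move=> hd he; rewrite (fuelE d) // (fuelE e).
Qed.

(* If m = s + \sum_k a_k *: lead k with s standard, then basis_mon m is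
   'X_[s] * \prod_k r k ^+ a_k. *)
Definition basis_mon m := replace_lead (mdeg m) m.

Lemma basis_monE m : basis_mon m =
  if [pick k | (lead k <= m)%MM] is Some k
  then basis_mon (m - lead k)%MM * r k else 'X_[m].
Proof.
have -> : basis_mon m = replace_lead (mdeg m).+1 m.
  by apply: replace_lead_fuel.
rewrite /=; case: pickP => // k km; congr (_ * _).
by apply: replace_lead_fuel => //; apply/ltnW/mdeg_subl.
Qed.

Lemma basis_mon_standard m : standard m -> basis_mon m = 'X_[m].
Proof.
move=> /forallP ms; rewrite basis_monE; case: pickP => // k km.
by have := ms k; rewrite km.
Qed.

(** [pick] may extract some [lead j] other than [lead k]; by coprimality it then divides [m] itself,
    and induction on the degree lets the two extractions commute. *)
Lemma basis_monD m k : basis_mon (m + lead k)%MM = basis_mon m * r k.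
Proof.
have [d] := ubnP (mdeg m); elim: d m k => // d IH m k hm.
rewrite basis_monE; case: pickP => [j jmk|/(_ k)]; last by rewrite lem_addl.
have [->|jk] := eqVneq j k; first by rewrite addmK.
have jm : (lead j <= m)%MM.
  apply/mnm_lepP => i; have /mnm_lepP/(_ i) := jmk; rewrite mnmDE.
  by case/orP: (lead_coprime i jk) => /eqP->; rewrite ?addn0.
have mE : (m + lead k - lead j = m - lead j + lead k)%MM.
  by rewrite -{1}(submK jm) -addmA (addmC (lead j)) addmA addmK.
have lt : (mdeg (m - lead j)%MM < d)%N.
  by apply: leq_trans (mdeg_subl jm) _; rewrite -ltnS.
by rewrite mE IH // -{2}(submK jm) IH // mulrAC.
Qed.

Lemma basis_mon_lower m : lower (W m) (basis_mon m - 'X_[m]).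
Proof.
have [d] := ubnP (mdeg m); elim: d m => // d IH m hm.
rewrite basis_monE; case: pickP => [k km|_]; last first.
  by rewrite subrr => m'; rewrite msupp0.
have lt : (mdeg (m - lead k)%MM < d)%N.
  by apply: leq_trans (mdeg_subl km) _; rewrite -ltnS.
rewrite -[X in 'X_[X]](submK km) -[X in W X](submK km) weightD mpolyXD.
set b := basis_mon _; set x := 'X_[m - _].
(* Telescoping puts a factor of strictly lower weight, [b - x] or [r k - 'X_[lead k]], into each
   summand. *)
have -> : b * r k - x * 'X_[lead k] = (b - x) * r k + (r k - 'X_[lead k]) * x.
  by rewrite !mulrBl (mulrC (r k) x) addrA subrK mulrC (mulrC 'X_[_] x).
apply: lowerD; last by rewrite addnC; apply: lowerM => //; apply: lowerX.
apply: lowerM; first exact: IH.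
rewrite -(subrK 'X_[lead k] (r k)); apply: lowerD; last exact: lowerX.
by move=> m' /r_lead/leqW.
Qed.

(** * The linear endomorphism that replaces each [lead k] by [r k] *)

Definition basis_map (p : {mpoly K[n]}) : {mpoly K[n]} :=
  \sum_(m <- msupp p) p@_m *: basis_mon m.

(** Linearity needs several polynomials expanded over one common list of monomials. *)
Lemma basis_map_sub p s : uniq s -> {subset msupp p <= s} ->
  basis_map p = \sum_(m <- s) p@_m *: basis_mon m.
Proof.
move=> us ps; rewrite (bigID (fun m => m \in msupp p)) /= addrC big1 ?add0r.
  rewrite -big_filter; apply/perm_big/uniq_perm.
  - exact: msupp_uniq.
  - exact: filter_uniq.
  - by move=> m; rewrite mem_filter; case: (boolP (m \in msupp p)) => // /ps ->.
by move=> m /memN_msupp_eq0 ->; rewrite scale0r.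
Qed.

Lemma basis_map_is_linear : linear basis_map.
Proof.
move=> c p q; pose s := undup (msupp p ++ msupp q ++ msupp (c *: p + q)).
have us : uniq s by apply: undup_uniq.
rewrite !(@basis_map_sub _ s) //;
  try by move=> m h; rewrite mem_undup !mem_cat h ?orbT.
rewrite scaler_sumr -big_split /=; apply: eq_bigr => m _.
by rewrite mcoeffD mcoeffZ scalerDl scalerA.
Qed.

HB.instance Definition _ := GRing.isLinear.Build K {mpoly K[n]} {mpoly K[n]}
  *:%R basis_map basis_map_is_linear.

Lemma basis_mapX m : basis_map 'X_[m] = basis_mon m.
Proof. by rewrite /basis_map msuppX big_seq1 mcoeffX eqxx scale1r. Qed.

Lemma basis_map_standard p :
  (forall m, m \in msupp p -> standard m) -> basis_map p = p.
Proof.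
move=> hp; rewrite [RHS]mpolyE /basis_map big_seq [RHS]big_seq.
by apply: eq_bigr => m /hp hm; rewrite basis_mon_standard.
Qed.

(** [basis_map] need not be multiplicative in general, but [basis_monD] makes it so for the factors
    [lead k]. *)
Lemma basis_mapM p k : basis_map (p * 'X_[lead k]) = basis_map p * r k.
Proof.
rewrite {1}(mpolyE p) mulr_suml linear_sum mulr_suml; apply: eq_bigr => m _ /=.
by rewrite -scalerAl -mpolyXD linearZ /= basis_mapX basis_monD scalerAl.
Qed.

Lemma basis_map_lower p m :
  (forall m', m' \in msupp p -> (W m' <= W m)%N) -> lower (W m) (basis_map p - p).
Proof.
move=> hp; rewrite {2}(mpolyE p) /basis_map -sumrB.
apply: lower_sum => m' m'p _; rewrite -scalerBr; apply: lowerZ => x hx.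
exact: leq_trans (basis_mon_lower hx) (hp _ m'p).
Qed.

(** The term of a heaviest monomial of [p] cannot cancel, as [basis_map p - p] has only strictly
    lower weights. *)
Lemma basis_map_eq0 p : basis_map p = 0 -> p = 0.
Proof.
move=> p0; apply/eqP/contraT => pn0.
have [m mp mmax] : exists2 m, m \in msupp p &
    forall m', m' \in msupp p -> (W m' <= W m)%N.
  case: (msupp p) (msupp_eq0 p) => [|m0 s]; first by rewrite (negPf pn0).
  move=> _.
  (* The maximum is taken over indices into the support, because the monomials form no finite
     type. *)
  case: (@arg_maxnP _ ord0 xpredT
    (fun i : 'I_(size s).+1 => W (nth m0 (m0 :: s) i)) isT) => i _ imax.
  exists (nth m0 (m0 :: s) i); first exact: mem_nth.
  by move=> m' /(nthP m0)[j js <-]; apply: (imax (Ordinal js)).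
have := basis_map_lower mmax; rewrite p0 sub0r.
by move/lowerN; rewrite opprK => /(_ m mp); rewrite ltnn.
Qed.

(** Passing from [p] to [p - basis_map p] lowers the weight bound, a natural number, so the
    successive corrections end. *)
Lemma basis_map_surj p : exists q, basis_map q = p.
Proof.
have [d] : exists d, lower d p.
  exists (\max_(m <- msupp p) (W m).+1)%N => m mp.
  exact: (@leq_bigmax_seq _ _ xpredT (fun m => (W m).+1)).
elim: d p => [|d IH] p hp.
  exists 0; rewrite linear0; symmetry; apply: msuppnil0.
  by case E: (msupp p) hp => [//|m s] /(_ m); rewrite E inE eqxx => /(_ isT).
have lt : lower d (p - basis_map p).
  rewrite -opprB; apply: lowerN; rewrite {2}(mpolyE p) /basis_map -sumrB.
  apply: lower_sum => m mp _; rewrite -scalerBr; apply: lowerZ => x hx.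
  exact: leq_trans (basis_mon_lower hx) (hp _ mp).
have [q qE] := IH _ lt; exists (q + p).
by rewrite linearD /= qE subrK.
Qed.

(** * Standard monomials modulo the ideal of the [r k] *)

Lemma msupp_lead_sum (d : I -> {mpoly K[n]}) m :
  m \in msupp (\sum_k d k * 'X_[lead k]) -> ~~ standard m.
Proof.
move=> /msupp_sum_le/flattenP[s /mapP[k _ ->]].
move=> /msuppM_le/allpairsP[[m1 m2] /= [_ /mem_msuppXP <- ->]].
by apply/forallPn; exists k; rewrite negbK lem_addl.
Qed.

(** Pulled back along [basis_map], the relation becomes [p = \sum_k d k * 'X_[lead k]], and the
    right side has no standard monomial. *)
Lemma standard_in_ideal p (c : I -> {mpoly K[n]}) :
  (forall m, m \in msupp p -> standard m) -> p = \sum_k c k * r k -> p = 0.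
Proof.
move=> hp pE; have [d dE] := boolp.choice (fun k => basis_map_surj (c k)).
have E : basis_map (p - \sum_k d k * 'X_[lead k]) = 0.
  rewrite linearB /= basis_map_standard // {1}pE (linear_sum basis_map) -sumrB.
  by rewrite big1 // => k _; rewrite /= basis_mapM dE subrr.
have /eqP := basis_map_eq0 E; rewrite subr_eq0 => /eqP pd.
apply: msuppnil0; case Es: (msupp p) => [//|m s].
have mp : m \in msupp p by rewrite Es mem_head.
by move: (mp); rewrite pd => /msupp_lead_sum; rewrite hp.
Qed.

(** With [p] written as [basis_map p'], the standard monomials of [p'] make up [q] and the others
    yield multiples of the [r k]. *)
Lemma standard_span p : exists2 q : {mpoly K[n]},
  (forall m, m \in msupp q -> standard m) &
  exists c : I -> {mpoly K[n]}, p - q = \sum_k c k * r k.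
Proof.
have [p' <-] := basis_map_surj p.
elim/mpolyind: p' => [|a m p' _ _ [q qs [c cE]]].
  exists 0; first by move=> m; rewrite msupp0.
  by exists (fun=> 0); rewrite linear0 subrr big1 // => k _; rewrite mul0r.
rewrite linearP /= basis_mapX.
have [ms|] := boolP (standard m).
  exists (a *: 'X_[m] + q).
    move=> m' /msuppD_le; rewrite mem_cat => /orP[/msuppZ_le|/qs //].
    by move=> /mem_msuppXP <-.
  by exists c; rewrite basis_mon_standard // opprD addrACA subrr add0r.
case/forallPn=> k; rewrite negbK => km; exists q => //.
exists (fun j => (if j == k then a *: basis_mon (m - lead k) else 0) + c j).
under eq_bigr do rewrite mulrDl.
rewrite big_split /= -cE (bigD1 k) //= eqxx big1 ?addr0 => [|j /negPf->].
  by rewrite -addrA -scalerAl -basis_monD submK.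
by rewrite mul0r.
Qed.

End CoprimeLeadMonomials.

(** * The weak order as a comparison of positions *)

Section WeakOrder.
Import Defs.
Set Implicit Arguments.
Unset Strict Implicit.
Unset Printing Implicit Defensive.
Variable n : nat.

Definition is_h T (a : sym n T) := if a is symh _ then true else false.

(* g_n[t] and f^n[t+1] get the same position, which makes the weak order the
   comparison of positions, apart from reflexivity. *)
Definition pos (a : sym n int) : int :=
  match a with
  | symf i t => 2 * n%:Z * t - i.+1%:Z
  | symg i t => 2 * n%:Z * t + i.+1%:Z
  | symh t => 2 * n%:Z * t
  end.

(** Each generating relation between distinct elements raises [pos] by 1, and reflexivity is
    generated at the f's and g's only. *)
Lemma wle_pos a b : wle a b -> pos a < pos b \/ a = b /\ ~~ is_h a.
Proof.
elim=> {a b} [i j t h|i t h|i t h|i j t h|i j t h h'|i j t h h'|i t|i t|a b c _ ab _ bc];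
  try by right.
all: try by left; rewrite /=; lia.
case: ab bc => [ab|[-> _]] // [bc|[<- _]]; left=> //; exact: lt_trans bc.
Qed.

Hypothesis n_ge2 : (2 <= n)%N.

Lemma wle_adjacent a b : pos b = pos a + 1 -> wle a b.
Proof.
(* Comparing the labels first tames their products with [n]; only equal or consecutive labels
   survive. *)
have tP (t t' : int) : [\/ t' <= t - 1, t' = t, t' = t + 1 | t' >= t + 2].
  have : (t' <= t - 1) || (t' == t) || (t' == t + 1) || (t' >= t + 2) by lia.
  by case/orP=> [/orP[/orP[]|/eqP]|]; [constructor 1|move/eqP; constructor 2|
    constructor 3|constructor 4].
case: a b => [i t|i t|t] [j t'|j t'|t'] /= E.
all: have hi := n_ge2; try have {}hi := ltn_ord i; try have hj := ltn_ord j.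
all: case: (tP t t') => ht; try (exfalso; nia).
all: try subst t'.
- by apply: wle_ff; lia.
- have ij : i = 0%N :> nat by lia.
  exact: wle_fh.
(* The two passages to the next label: g_n[t] < f^{n-1}[t+1] and g_{n-1}[t] < f^n[t+1]. *)
- have [hi'|hi'] : i.+1 = n \/ i.+2 = n by lia.
    by apply: wle_gf' => //; lia.
  by apply: wle_gf => //; lia.
- by apply: wle_gg; lia.
- by apply: wle_hg; lia.
Qed.

Lemma pos_succ a : exists b, pos b = pos a + 1.
Proof.
case: a => [i t|i t|t].
- case: i => [[|i] hi]; first by exists (symh t); rewrite /=; lia.
  by exists (symf (Ordinal (ltnW hi)) t); rewrite /=; lia.
- have [hi|hi] := ltnP i.+1 n; first by exists (symg (Ordinal hi) t); rewrite /=; lia.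
  (* The successor of g_n[t] is f^{n-1}[t+1], of shifted index [n.-2], because f^n[t+1] shares the
     position of g_n[t]. *)
  have hj : (n.-2 < n)%N by lia.
  by exists (symf (Ordinal hj) (t + 1)); rewrite /=; have := ltn_ord i; lia.
- have hj : (0 < n)%N by lia.
  by exists (symg (Ordinal hj) t); rewrite /=; lia.
Qed.

Lemma pos_wle a b : pos a < pos b -> wle a b.
Proof.
move=> ab; have [d dE] : exists d : nat, pos b = pos a + d.+1%:Z.
  by exists `|pos b - pos a|.-1%N; lia.
elim: d a dE {ab} => [|d IH] a dE; first exact: wle_adjacent.
have [c cE] := pos_succ a; apply: (wle_trans (wle_adjacent cE)).
by apply: IH; rewrite dE cE; lia.
Qed.

Lemma wcomparableP a b :
  wcomparable a b <-> pos a != pos b \/ a = b /\ ~~ is_h a.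
Proof.
split=> [[/wle_pos|/wle_pos]|].
- by case=> [|?]; [rewrite lt_neqAle => /andP[? _]; left | right].
- case=> [|[-> ?]]; last by right.
  by rewrite lt_neqAle eq_sym => /andP[? _]; left.
case=> [|[<-]].
  by rewrite neq_lt => /orP[/pos_wle|/pos_wle]; [left | right].
by case: a => // i t _; left; [apply: wle_refl_f | apply: wle_refl_g].
Qed.

End WeakOrder.

Lemma big_option (V : nmodType) (I : finType) (F : option I -> V) :
  \sum_o F o = \sum_i F (Some i) + F None.
Proof.
rewrite (bigD1 None) //= addrC; congr (_ + _).
rewrite (reindex_omap Some id) => [|[i|]] //=.
by apply: eq_bigl => i; rewrite eqxx.
Qed.

(** * Positions, weights and leading terms for the generators of the algebra *)

Section Generators.
Import Defs.
Set Implicit Arguments.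
Unset Strict Implicit.
Unset Printing Implicit Defensive.

Variables (K : fieldType) (n N1 N2 : nat).
Hypothesis n_ge2 : (2 <= n)%N.

Local Notation M := (N1 + N2)%N.
Local Notation label := 'I_M.+1.
Local Notation G := (gen n N1 N2).
Local Notation mon := 'X_{1..#|{: G}|}.
Local Notation U a := (U_(enum_rank (a : G)))%MM.

(** This is [pos] translated so that f^n[-N_1] sits at 0, which keeps the weights in the natural
    numbers. *)
Definition gpos (a : G) : nat :=
  match a with
  | symf i s => (2 * n * s + n - i.+1)%N
  | symg i s => (2 * n * s + n + i.+1)%N
  | symh s => (2 * n * s + n)%N
  end.

Lemma pos_gen_sym a :
  pos (gen_sym a) = (gpos a)%:Z - n%:Z - 2 * n%:Z * N1%:Z.
Proof.
by case: a => [i s|i s|s] /=; rewrite /lab; have := n_ge2;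
  try have := ltn_ord i; nia.
Qed.

(* The total only keeps the truncated subtraction from reaching 0. *)
Definition wt (a : G) : nat := (\sum_b gpos b ^ 2 - gpos a ^ 2)%N.

(** Among pairs of positions with sum [2 * c], the sum of squares is least only when both equal
    [c]. *)
Lemma wt_pair a b c : (gpos a + gpos b = 2 * c)%N -> (gpos a != gpos b) ->
  forall a' b', gpos a' = c -> gpos b' = c -> (wt a + wt b < wt a' + wt b')%N.
Proof.
move=> ab neq a' b' a'E b'E; rewrite /wt a'E b'E.
(* Hence no subtraction in [wt] is truncated. *)
have le x : (gpos x ^ 2 <= \sum_y gpos y ^ 2)%N by rewrite (bigD1 x) //= leq_addr.
have := le a; have := le b; have := le a'; rewrite a'E.
move: (\sum_y _)%N => C; rewrite -!mulnn; nia.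
Qed.

Definition W (m : mon) : nat := (\sum_i m i * wt (enum_val i))%N.

Lemma weightD m1 m2 : W (m1 + m2)%MM = (W m1 + W m2)%N.
Proof.
by rewrite /W -big_split /=; apply: eq_bigr => i _; rewrite mnmDE mulnDl.
Qed.

Lemma WU a : W (U a) = wt a.
Proof.
rewrite /W (bigD1 (enum_rank a)) //= big1 => [|i /negPf ia].
  by rewrite mnm1E eqxx enum_rankK mul1n addn0.
by rewrite mnm1E eq_sym ia.
Qed.

(* (s, t, Some i) stands for the term f^i[s] g_i[t], and (s, t, None) for
   h[s] h[t]. *)
Definition term := (label * label * option 'I_n)%type.

Definition fac1 (x : term) : G :=
  if x.2 is Some i then symf i x.1.1 else symh x.1.1.

Definition fac2 (x : term) : G :=
  if x.2 is Some i then symg i x.1.2 else symh x.1.2.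

Definition degree_term k (x : term) := (x.1.1 + x.1.2 == k)%N.

Lemma varM (a b : G) : var K a * var K b = 'X_[U a + U b].
Proof. by rewrite mpolyXD. Qed.

Lemma AQ_rel_terms k :
  AQ_rel K n N1 N2 (k%:Z - (2 * N1)%N%:Z)
  = \sum_(x | degree_term k x) var K (fac1 x) * var K (fac2 x).
Proof.
rewrite /AQ_rel pair_big_dep /=.
under eq_bigr do rewrite -(big_option (fun o =>
  if o is Some i then var K (symf i _) * var K (symg i _)
  else var K (symh _) * var K (symh _))).
rewrite pair_big /=; apply: eq_big => [[[s t] o]|[[s t] [i|]] _] //=.
by rewrite andbT /degree_term /= /lab; lia.
Qed.

Lemma gpos_term k x : degree_term k x ->
  (gpos (fac1 x) + gpos (fac2 x) = 2 * (n * k + n))%N.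
Proof.
case: x => [[s t] [i|]] /=; rewrite /degree_term /= => /eqP <-; last by nia.
by have := ltn_ord i; nia.
Qed.

Lemma ltn_pred_n : (n.-1 < n)%N. Proof. by lia. Qed.

(** For [k <= 2 * M] no [inord] falls back on its default: an odd such [k] has [k./2.+1 <= M]. *)
Definition lead_term (k : nat) : term :=
  if odd k then (inord k./2.+1, inord k./2, Some (Ordinal ltn_pred_n))
  else (inord k./2, inord k./2, None).

(** In the unshifted indices, f^i[s] and g_i[t] share a position iff n(s - t) = i; as 1 <= i <= n,
    this means i = n and s = t + 1. *)
Lemma term_eqP k x : (k <= 2 * M)%N ->
  (degree_term k x && (gpos (fac1 x) == gpos (fac2 x))) = (x == lead_term k).
Proof.
move=> kM; apply/idP/eqP.
  case: x => [[s t] [i|]]; rewrite /degree_term /fac1 /fac2 /= => /andP[/eqP E /eqP H].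
    have hi := ltn_ord i.
    have st : s = t.+1 :> nat by nia.
    have iE : i = n.-1 :> nat by nia.
    have kE : k = t.*2.+1 by lia.
    rewrite /lead_term kE /= odd_double /= uphalf_double.
    by congr (_, _, Some _); apply/val_inj; rewrite /= ?inordK // -?st.
  have st : s = t :> nat by nia.
  have kE : k = t.*2 by lia.
  rewrite /lead_term kE odd_double doubleK.
  by congr (_, _, _); apply/val_inj; rewrite /= ?inordK.
move=> ->; rewrite /lead_term /degree_term /fac1 /fac2.
by have := odd_double_half k; case: (odd k) => /= kE; rewrite !inordK //; lia.
Qed.

Lemma lead_term_degree k : (k <= 2 * M)%N -> degree_term k (lead_term k).
Proof. by move=> kM; have := term_eqP (lead_term k) kM; rewrite eqxx => /andP[]. Qed.

Lemma gpos_lead k : (k <= 2 * M)%N ->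
  gpos (fac1 (lead_term k)) = (n * k + n)%N /\
  gpos (fac2 (lead_term k)) = (n * k + n)%N.
Proof.
move=> kM; have := term_eqP (lead_term k) kM; rewrite eqxx => /andP[/gpos_term].
by move=> + /eqP E; rewrite E; lia.
Qed.

Definition lead (k : 'I_(2 * M).+1) : mon :=
  (U (fac1 (lead_term k)) + U (fac2 (lead_term k)))%MM.

Definition quadric (k : 'I_(2 * M).+1) : genpoly K n N1 N2 :=
  AQ_rel K n N1 N2 (k%:Z - (2 * N1)%N%:Z).

Lemma lead_neq0 k : lead k != 0%MM.
Proof. by rewrite /lead mnmD_eq0 mnm1_eq0. Qed.

(** Every variable of [lead k] has position [n * k + n], which determines [k]. *)
Lemma lead_coprime j k i : j != k -> (lead j i == 0)%N || (lead k i == 0)%N.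
Proof.
have supp l : lead l i != 0%N -> gpos (enum_val i) = (n * l + n)%N.
  have [e1 e2] := gpos_lead (ltn_ord l).
  rewrite /lead mnmDE !mnm1E; case: (enum_rank _ =P i) => [<-|_]; first by rewrite enum_rankK.
  by case: (enum_rank _ =P i) => [<-|//]; rewrite enum_rankK.
apply: contraR; rewrite negb_or => /andP[/supp Ej /supp Ek].
by apply/eqP/val_inj => /=; rewrite Ej in Ek; nia.
Qed.

(** The leading term occurs once in the sum, with coefficient 1; the factors of every other term
    have unequal positions, so [wt_pair] applies. *)
Lemma quadric_lead k : lower W (W (lead k)) (quadric k - 'X_[lead k]).
Proof.
have kM : (k <= 2 * M)%N := ltn_ord k.
have [e1 e2] := gpos_lead kM.
rewrite /quadric AQ_rel_terms (bigD1 (lead_term k)) /=; last exact: lead_term_degree.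
rewrite varM [X in X - _]addrC addrK.
apply: lower_sum => x _ /andP[kx xl].
rewrite varM; apply: lowerX; rewrite !weightD !WU.
apply: wt_pair (gpos_term kx) _ _ _ e1 e2.
by apply: contra xl => h; rewrite -term_eqP // kx.
Qed.

Lemma lead_of_term x : gpos (fac1 x) = gpos (fac2 x) ->
  exists k, (U (fac1 x) + U (fac2 x))%MM = lead k.
Proof.
move=> E; have kM : (x.1.1 + x.1.2 < (2 * M).+1)%N.
  by have := ltn_ord x.1.1; have := ltn_ord x.1.2; lia.
exists (Ordinal kM); rewrite /lead /=.
suff /eqP <- : x == lead_term (x.1.1 + x.1.2) by [].
by rewrite -(term_eqP _ kM) E eqxx andbT /degree_term.
Qed.

(** Comparisons of labels are turned into linear facts about the products [2 * n * s], for use by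
    [lia]. *)
Lemma mul2n_cmp (s t : nat) :
  [\/ (2 * n * s + 2 * n <= 2 * n * t)%N, s = t, s = t.+1 |
      (2 * n * t + 4 * n <= 2 * n * s)%N].
Proof.
case: (ltngtP s t) => [st|ts|]; last by constructor 2.
  by constructor 1; rewrite -mulnSr leq_mul2l st orbT.
have [->|ne] := eqVneq s t.+1; first by constructor 3.
have ts2 : (t.+2 <= s)%N by lia.
constructor 4; apply: leq_trans (_ : 2 * n * t.+2 <= _)%N; last by rewrite leq_mul2l ts2 orbT.
by lia.
Qed.

Lemma incomparable_lead (a b : G) : ~ wcomparable (gen_sym a) (gen_sym b) ->
  exists k, (U a + U b)%MM = lead k.
Proof.
move=> /wcomparableP => /(_ n_ge2)/not_orP[/negP/negPn/eqP].
rewrite !pos_gen_sym => ab nab.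
have {ab} ab : gpos a = gpos b by lia.
have label_eq (s t : label) : s = t :> nat -> s = t by move/val_inj.
have index_eq (i j : 'I_n) : i = j :> nat -> i = j by move/val_inj.
case: a b ab nab => [i s|i s|s] [j t|j t|t] ab nab; move: (ab) => /=.
all: try have hi := ltn_ord i; try have hj := ltn_ord j.
all: case: (mul2n_cmp s t) (mul2n_cmp t s) => st [] ts ab'; try by exfalso; lia.
(* The pairs left are ff, fg, gf, gg and hh; ff and gg are equal elements, hence comparable, and the
   rest are leading monomials. *)
- have ij : i = j by apply: index_eq; nia.
  by case: nab; rewrite (label_eq _ _ st) ij.
- have ij : i = j by apply: index_eq; nia.
  by subst j; apply: (lead_of_term (x := (s, t, Some i))).
- have ij : i = j by apply: index_eq; nia.
  by subst j; rewrite addmC; apply: (lead_of_term (x := (t, s, Some i))).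
- have ij : i = j by apply: index_eq; nia.
  by case: nab; rewrite (label_eq _ _ st) ij.
- exact: (lead_of_term (x := (s, t, None))).
Qed.

Lemma lead_incomparable (k : 'I_(2 * M).+1) :
  ~ wcomparable (gen_sym (fac1 (lead_term k))) (gen_sym (fac2 (lead_term k))) /\
  ~ wcomparable (gen_sym (fac2 (lead_term k))) (gen_sym (fac1 (lead_term k))).
Proof.
have [e1 e2] := gpos_lead (ltn_ord k).
split=> /(wcomparableP n_ge2); rewrite !pos_gen_sym e1 e2 eqxx => -[//|[]];
  rewrite /lead_term; by case: odd.
Qed.

Lemma mon_prod k (a : 'I_k -> G) :
  \prod_(i < k) var K (a i) = 'X_[\sum_(i < k) U (a i)].
Proof. by rewrite (big_morph _ (@mpolyXD _ K) (mpolyX0 _ _)). Qed.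

Lemma mon_ex (m : mon) : exists k (a : 'I_k -> G), m = (\sum_(i < k) U (a i))%MM.
Proof.
have [d] := ubnP (mdeg m); elim: d m => // d IH m hm.
have [->|m0] := eqVneq m 0%MM.
  (* The value [symh ord0] is arbitrary, since the domain is empty. *)
  by exists 0%N, (fun=> symh ord0); rewrite big_ord0.
have [i mi] : exists i, m i != 0%N.
  apply/existsP; rewrite -negb_forall; apply: contra m0 => /forallP h.
  by apply/eqP/mnmP => i; rewrite mnm0E; apply/eqP/h.
have im : (U_(i) <= m)%MM.
  by apply/mnm_lepP => j; rewrite mnm1E; case: eqP => // <-; rewrite lt0n.
have [|k [a aE]] := IH (m - U_(i))%MM.
  by move: hm; rewrite -{1}(submK im) mdegD mdeg1 addn1.
exists k.+1, (fun j => if unlift ord0 j is Some j' then a j' else enum_val i).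
rewrite big_ord_recl unlift_none enum_valK -{1}(submK im) addmC aE; congr (_ + _)%MM.
by apply: eq_bigr => j _; rewrite liftK.
Qed.

(** Incomparable factors at two distinct places are the same thing as a divisor [lead l]. *)
Lemma GmonomialsP p : Gmonomials K n N1 N2 p <->
  exists2 m, standard lead m & p = 'X_[m].
Proof.
split=> [[k [a [-> ha]]]|[m /forallP ms ->]].
  exists (\sum_(i < k) U (a i))%MM; last exact: mon_prod.
  apply/forallP => l; apply/negP => /mnm_lepP le.
  have [i ai] : exists i, a i = fac1 (lead_term l).
    have := le (enum_rank (fac1 (lead_term l))).
    rewrite /lead mnmDE mnm1E eqxx mnm_sumE => h.
    have [i /eqP e|none] := pickP (fun i => a i == fac1 (lead_term l)); first by exists i.
    move: h; rewrite big1 // => i _; rewrite mnm1E.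
    by rewrite (inj_eq enum_rank_inj) none.
  (* Place [i] is set aside before counting, so a second place is found even when both factors are
     the same h[t]. *)
  have [j ji aj] : exists2 j, j != i & a j = fac2 (lead_term l).
    have := le (enum_rank (fac2 (lead_term l))).
    rewrite /lead mnmDE mnm_sumE (bigD1 i) //= ai leq_add2l mnm1E eqxx => h.
    have [j /andP[ji /eqP e]|none] :=
      pickP (fun j => (j != i) && (a j == fac2 (lead_term l))); first by exists j.
    move: h; rewrite big1 // => j ji; rewrite mnm1E (inj_eq enum_rank_inj).
    by have := none j; rewrite /= ji /= => ->.
  by have := ha j i ji; rewrite ai aj; case: (lead_incomparable l).
have [k [a mE]] := mon_ex m; exists k, a; split; first by rewrite mon_prod mE.
move=> i j ij; apply: contrapT => /incomparable_lead[l lE].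
have := ms l; rewrite -lE mE (bigD1 i) //= (bigD1 j) 1?eq_sym //= addmA.
by rewrite lem_addr.
Qed.

(** * Independence and spanning in the quotient *)

Lemma AQ_ideal_standard (p : genpoly K n N1 N2) :
  (forall m, m \in msupp p -> standard lead m) -> AQ_pi K n N1 N2 p = 0 -> p = 0.
Proof.
move=> hp p0; have : AQ_pi K n N1 N2 p = AQ_pi K n N1 N2 0 by rewrite p0 rmorph0.
move=> /AQ_piP; rewrite subr0 => /asboolP[c pE].
exact: (standard_in_ideal weightD lead_neq0 lead_coprime quadric_lead hp pE).
Qed.

Lemma AQ_pi_Gmonomials_inj :
  {in Gmonomials K n N1 N2 &, injective (AQ_pi K n N1 N2)}.
Proof.
move=> p q; rewrite !in_setE => /GmonomialsP[m ms ->] /GmonomialsP[m' ms' ->] E.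
apply/eqP; rewrite -subr_eq0; apply/eqP/AQ_ideal_standard; last first.
  by rewrite rmorphB /= E subrr.
move=> x /msuppB_le; rewrite mem_cat.
by case/orP=> /mem_msuppXP <-.
Qed.

Lemma AQ_pi_Gmonomials_basis :
  is_basis [set AQ_pi K n N1 N2 p | p in Gmonomials K n N1 N2].
Proof.
split.
  move=> s c us sB s0.
  (* A standard monomial is chosen above each element of [s], to lift the relation to a polynomial
     with standard support. *)
  have /boolp.choice[m mE] : forall x, exists m : mon,
      x \in s -> standard lead m /\ AQ_pi K n N1 N2 'X_[m] = x.
    move=> x; case: (boolP (x \in s)) => [xs|_]; last by exists 0%MM.
    by have [p /GmonomialsP[m ms ->] px] := sB x xs; exists m.
  pose q : genpoly K n N1 N2 := \sum_(x <- s) c x *: 'X_[m x].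
  have q0 : q = 0.
    apply: AQ_ideal_standard.
      move=> y /msupp_sum_le/flattenP[t /mapP[x]]; rewrite mem_filter /= => xs ->.
      by move=> /msuppZ_le/mem_msuppXP <-; case: (mE x xs).
    rewrite -s0 raddf_sum /= big_seq [RHS]big_seq; apply: eq_bigr => x xs.
    by rewrite linearZ /=; case: (mE x xs) => _ ->.
  move=> x xs; have := congr1 (mcoeff (m x)) q0.
  rewrite mcoeff0 raddf_sum /= (bigD1_seq x) //= mcoeffZ mcoeffX eqxx mulr1.
  rewrite big_seq_cond big1 ?addr0 // => y /andP[ys yx].
  rewrite mcoeffZ mcoeffX; case: eqP => [e|_]; last by rewrite mulr0.
  by case/eqP: yx; case: (mE x xs) (mE y ys) => _ <- [_ <-]; rewrite e.
move=> v; have [p <-] := AQ_pi_surj v.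
have [q qs [c cE]] := standard_span weightD lead_neq0 lead_coprime quadric_lead p.
have -> : AQ_pi K n N1 N2 p = AQ_pi K n N1 N2 q.
  by apply/AQ_piP/asboolP; exists c.
pose e (m : mon) : AQ K n N1 N2 := AQ_pi K n N1 N2 'X_[m].
have einj : {in msupp q &, injective e}.
  move=> m m' /qs ms /qs ms' ee.
  have inG x : standard lead x -> 'X_[x] \in Gmonomials K n N1 N2.
    by move=> xs; rewrite in_setE; apply/GmonomialsP; exists x.
  have /(congr1 (mcoeff m)) := AQ_pi_Gmonomials_inj (inG _ ms) (inG _ ms') ee.
  rewrite !mcoeffX eqxx; case: eqP => [-> //|_] /eqP.
  by rewrite oner_eq0.
(* By [einj] this choice inverts [e] on the support of [q], so each image gets back its own
   coefficient. *)
have /boolp.choice[m mE] : forall x, exists m : mon,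
    x \in map e (msupp q) -> m \in msupp q /\ e m = x.
  move=> x; case: (boolP (x \in map e (msupp q))) => [/mapP[m mq ->]|_].
    by exists m.
  by exists 0%MM.
exists (map e (msupp q)), (fun x => q@_(m x)); split.
  move=> x /mapP[y yq ->]; exists 'X_[y] => //.
  by apply/GmonomialsP; exists y => //; apply: qs.
rewrite big_map {1}(mpolyE q) raddf_sum /= big_seq [RHS]big_seq.
apply: eq_bigr => y yq; rewrite linearZ /=; congr (_@_ _ *: _).
have [mq me] := mE _ (map_f e yq); exact/einj.
Qed.

End Generators.

(** Injectivity is stated separately because a set of images would hide coincidences between
    distinct monomials. *)
Theorem theorem13 (R : realType) (n N1 N2 : nat) (hn : (2 <= n)%N) :
  {in Gmonomials R[i] n N1 N2 &, injective (AQ_pi R[i] n N1 N2)} /\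
  is_basis [set AQ_pi R[i] n N1 N2 p | p in Gmonomials R[i] n N1 N2].
Proof.
split; first exact: AQ_pi_Gmonomials_inj.
exact: AQ_pi_Gmonomials_basis.
Qed.
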